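(* Let $U=\{u\in\mathbb{R}^p\mid h_1(u)\ge0,\dots,h_{m_1}(u)\ge0\}$ with $h_1,\dots,h_{m_1}\in\mathbb{R}[u]$ nonzero polynomials, and suppose that $U$ is not closed at $\infty$. Let $0\ne\bar u\in\mathbb{R}^p$ be such that $(0,\bar u)\in\widetilde U$ but $(0,\bar u)$ is not in the closure of $U_0$. For $i\in\{1,\dots,m_1\}$ let $\hat h_i$ be the homogeneous part of highest degree of $h_i$, let $\hat h_{m_1+1}(u):=\|u\|^2-1$, let $$\{j_1,\dots,j_\ell\}:=\{j\in\{1,\dots,m_1\}\mid \hat h_j(\bar u)=0\},$$ and let $J(\bar u)=\{j_1,\dots,j_\ell,m_1+1\}$. Then: (a) If $|J(\bar u)|>p$, then for every subset $\{i_1,\dots,i_{p+1}\}\subseteq J(\bar u)$ of $p+1$ elements, $$Res(\hat h_{i_1},\dots,\hat h_{i_{p+1}})=0.$$ (b) If $|J(\bar u)|\le p$, then $$\Delta(\hat h_{j_1},\dots,\hat h_{j_\ell},\hat h_{m_1+1})=0.$$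
   Context: For $q\in\mathbb{R}[u]=\mathbb{R}[u_1,\dots,u_p]$ of degree $d$, $\tilde q(\tilde u)=u_0^d q(u/u_0)$ is its homogenization, $\tilde u=(u_0,u)\in\mathbb{R}^{p+1}$. The sets are $U_0=\{\tilde u\in\mathbb{R}^{p+1}\mid \tilde h_1(\tilde u)\ge0,\dots,\tilde h_{m_1}(\tilde u)\ge0,\ u_0>0,\ \|\tilde u\|^2=1\}$ and $\widetilde U=\{\tilde u\in\mathbb{R}^{p+1}\mid \tilde h_1(\tilde u)\ge0,\dots,\tilde h_{m_1}(\tilde u)\ge0,\ u_0\ge0,\ \|\tilde u\|^2=1\}$. $U$ (with its description by the $h_i$) is closed at $\infty$ if the Euclidean closure of $U_0$ equals $\widetilde U$. (If $U$ is not closed at $\infty$, a $\bar u$ as in the claim exists.) Note $\tilde h_j(0,\bar u)=\hat h_j(\bar u)$. Resultants and discriminants. For homogeneous polynomials $F_1,\dots,F_N$ in $N$ variables, the resultant $Res(F_1,\dots,F_N)$ is a polynomial in their coefficients with $Res(F_1,\dots,F_N)=0$ if and only if there is $0\ne v\in\mathbb{C}^N$ with $F_1(v)=\cdots=F_N(v)=0$. For homogeneous polynomials $F_1,\dots,F_m$ in $N$ variables with $m<N$, the discriminant $\Delta(F_1,\dots,F_m)$ is a polynomial in their coefficients with $\Delta(F_1,\dots,F_m)=0$ if and only if the system $F_1=\cdots=F_m=0$ has a solution $0\ne v\in\mathbb{C}^N$ at which the Jacobian matrix of $F_1,\dots,F_m$ does not have full rank. In the claim, all $\hat h_i$ are regarded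 as (not necessarily homogeneous) polynomials in the $p$ variables $u_1,\dots,u_p$, and for such polynomials $Res$ (of $p+1$ polynomials) and $\Delta$ (of $m\le p$ polynomials) are by definition the resultant, respectively the discriminant, of their homogenizations in the $p+1$ variables $(u_0,u_1,\dots,u_p)$. *)

(* Defs.v *)
From HB Require Import structures.
From mathcomp Require Import all_boot all_order all_algebra.
(* mpoly must be loaded before topology: in the other order their notations
   clash. *)
From mathcomp Require Import mpoly.
From mathcomp Require Import complex.
From mathcomp Require Import boolp classical_sets reals.
From mathcomp Require Import topology normedtype.

Set Implicit Arguments.
Unset Strict Implicit.
Unset Printing Implicit Defensive.

Import Order.TTheory GRing.Theory Num.Theory.
Import numFieldNormedType.Exports.

Local Open Scope classical_set_scope.
Local Open Scope ring_scope.

(* Also 0 when q = 0. *)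
Definition deg (n : nat) (R : nzRingType) (q : {mpoly R[n]}) : nat :=
  (msize q).-1.

(* u_0^(deg q) q(u / u_0): u_0 is the variable of index ord0 and u_(i+1) the one
   of index lift ord0 i. *)
Definition homogenize (p : nat) (R : comNzRingType) (q : {mpoly R[p]}) :
    {mpoly R[p.+1]} :=
  \sum_(m <- msupp q)
     q@_m *: ('X_ord0 ^+ (deg q - mdeg m) *
              \prod_(i < p) 'X_(lift ord0 i) ^+ (m i)).

Definition top_part (p : nat) (R : nzRingType) (q : {mpoly R[p]}) :
    {mpoly R[p]} :=
  pihomog mdeg (deg q) q.

Section Systems.

Variables (K : closedFieldType) (N m : nat).
Implicit Types (d : 'I_m -> nat) (F : 'I_m -> {mpoly K[N]}).

(* A system of m forms of degrees d in N variables has one coefficient for each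
   pair of an index i : 'I_m and a monomial of degree d i. *)
Definition coef_index d : finType :=
  {i : 'I_m & {b : 'X_{1..N < (d i).+1} | mdeg b == d i}}.

Definition coefs d F : 'I_#|coef_index d| -> K :=
  fun k => (F (tag (enum_val k)))@_(val (tagged (enum_val k))).

Definition is_zero F (v : 'I_N -> K) : Prop := forall i, (F i).@[v] = 0.

Definition jacobian F (v : 'I_N -> K) : 'M[K]_(m, N) :=
  \matrix_(i, k) ((F i)^`M(k)).@[v].

Definition is_singular_zero F (v : 'I_N -> K) : Prop :=
  is_zero F v /\ (\rank (jacobian F v) < minn m N)%N.

End Systems.

Arguments coefs {K N m} d F _.

(* Res, a polynomial in the coefficients of N forms of degrees d in N variables,
   is their resultant: it vanishes exactly on the systems with a common nonzero
   zero over K. This determines Res only up to normalization and multiplicities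
   of its factors, neither of which affects where it vanishes. It exists when
   all d i > 0. *)
Definition is_resultant (K : closedFieldType) (N : nat) (d : 'I_N -> nat)
    (Res : {mpoly K[#|coef_index N d|]}) : Prop :=
  forall F : 'I_N -> {mpoly K[N]}, (forall i, F i \is (d i).-homog) ->
    (Res.@[coefs d F] = 0 <->
     exists v : 'I_N -> K, (exists k, v k != 0) /\ is_zero F v).

(* Likewise Delta is the discriminant of m < N forms of degrees d in N variables:
   it vanishes exactly on the systems with a nonzero singular zero. It exists, in
   characteristic 0, when all d i > 0 and some d i > 1. *)
Definition is_discriminant (K : closedFieldType) (N m : nat) (d : 'I_m -> nat)
    (Delta : {mpoly K[#|coef_index N d|]}) : Prop :=
  forall F : 'I_m -> {mpoly K[N]}, (forall i, F i \is (d i).-homog) ->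
    (Delta.@[coefs d F] = 0 <->
     exists v : 'I_N -> K, (exists k, v k != 0) /\ is_singular_zero F v).

Arguments is_resultant {K N} d Res.
Arguments is_discriminant {K N m} d Delta.

Definition degs (p m : nat) (R : nzRingType) (q : 'I_m -> {mpoly R[p]}) :
    'I_m -> nat :=
  fun k => deg (q k).

(* The value of P, a resultant or discriminant of m forms in p.+1 variables, at
   m not necessarily homogeneous real polynomials in p variables. *)
Definition value_at (R : realType) (p m : nat) (q : 'I_m -> {mpoly R[p]})
    (P : {mpoly R[i][#|coef_index p.+1 (degs q)|]}) : R[i] :=
  P.@[coefs (degs q) (fun k => map_mpoly (real_complex R) (homogenize (q k)))].

Arguments value_at {R p m} q P.

Section ClosedAtInfinity.

Variables (R : realType) (p m1 : nat) (h : 'I_m1 -> {mpoly R[p]}).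

Definition U0 : set 'rV[R]_p.+1 :=
  [set w | [/\ forall i, 0 <= (homogenize (h i)).@[w ord0],
               0 < w ord0 ord0
             & \sum_k w ord0 k ^+ 2 = 1]].

Definition Utilde : set 'rV[R]_p.+1 :=
  [set w | [/\ forall i, 0 <= (homogenize (h i)).@[w ord0],
               0 <= w ord0 ord0
             & \sum_k w ord0 k ^+ 2 = 1]].

(* A property of the description h of the set of the u with all (h i)(u) >= 0,
   not of this set alone. The topology of row vectors (sup norm) is the
   Euclidean one. *)
Definition closed_at_infinity : Prop := closure U0 = Utilde.

(* hhat ord_max is the extra polynomial |u|^2 - 1, of index m1 + 1. *)
Definition hhat (i : 'I_m1.+1) : {mpoly R[p]} :=
  if unlift ord_max i is Some j then top_part (h j)
  else (\sum_(k < p) 'X_k ^+ 2) - 1.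

Definition J (u : 'rV[R]_p) : {set 'I_m1.+1} :=
  ord_max |: [set lift ord_max j | j : 'I_m1 &
                (hhat (lift ord_max j)).@[u ord0] == 0].

End ClosedAtInfinity.

(* Main.v *)
Require Import Defs.
From mathcomp Require Import all_boot all_order all_algebra.
From mathcomp Require Import mpoly complex.
From mathcomp Require Import boolp classical_sets reals topology normedtype.
From mathcomp Require derive realfun.
From mathcomp Require Import ring.

Set Implicit Arguments.
Unset Strict Implicit.
Unset Printing Implicit Defensive.

Import Order.TTheory GRing.Theory Num.Theory.
Import numFieldNormedType.Exports.

Local Open Scope classical_set_scope.
Local Open Scope ring_scope.

(** Both vanishing statements are witnessed by the single point (1, ubar): the
    homogenization of a polynomial takes at (1, ubar) the value of the
    polynomial at ubar, so by definition of J all the homogenizations of the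
    hhat_j with j in J(ubar) vanish there (for the last one because
    |ubar| = 1). A common nonzero zero is all that the resultant asks for.

    For the discriminant it remains to see that (1, ubar) is a singular zero.
    Suppose that the Jacobian there has full row rank. It is a real matrix, so
    it has a real right inverse, and some real direction w makes all the
    directional derivatives equal to 1 ([real_direction_of_full_rank]). The
    forms hhat_j with hhat_j(ubar) = 0 then become positive when one leaves
    ubar a little along the last p coordinates of w; the other hhat_j are
    positive at ubar already. So (0, ubar) is a limit of points at infinity
    where all the homogenizations are positive. Each of these is in turn a limit
    of points with u_0 > 0 where they are still positive, and projecting
    radially to the sphere, which preserves the signs of forms, gives points of
    U_0 that tend to (0, ubar) ([closure_U0_of_direction]). This contradicts the
    choice of ubar.

    The limits are all taken along straight lines, on which a polynomial is a
    polynomial in the parameter whose coefficients of degree 0 and 1 are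
    the value and the directional derivative ([meval_line_expansion]). *)

(** * Polynomials: base change, first-order expansion, scaling *)

Lemma meval_map_mpoly (n : nat) (A B : comNzRingType) (f : {rmorphism A -> B})
    (q : {mpoly A[n]}) (v : 'I_n -> A) :
  (map_mpoly f q).@[f \o v] = f q.@[v].
Proof.
elim/mpolyind: q => [|c m q _ _ IHq]; first by rewrite !rmorph0.
rewrite rmorphD /= !mevalD rmorphD IHq map_mpolyZ map_mpolyX !mevalZ rmorphM.
rewrite !mevalX rmorph_prod; congr (_ * _ + _).
by apply: eq_bigr => i _; rewrite /= rmorphXn.
Qed.

Lemma mderiv_map_mpoly (n : nat) (A B : comNzRingType)
    (f : {rmorphism A -> B}) (q : {mpoly A[n]}) (k : 'I_n) :
  (map_mpoly f q)^`M(k) = map_mpoly f q^`M(k).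
Proof.
apply/mpolyP => m.
by rewrite mcoeff_mderiv !mcoeff_map_mpoly mcoeff_mderiv raddfMn.
Qed.

(** The chain rule along a line, in a form without division: the class of
    polynomials that have such an expansion contains the constants and the
    variables and is closed under sums and products. *)
Lemma meval_line_expansion (n : nat) (A : comNzRingType) (F : {mpoly A[n]})
    (v w : 'I_n -> A) :
  exists2 Q : {poly A}, Q.[0] = \sum_k (F^`M(k)).@[v] * w k &
    forall s, F.@[fun k => v k + s * w k] = F.@[v] + s * Q.[s].
Proof.
pose expands (G : {mpoly A[n]}) :=
  exists2 Q : {poly A}, Q.[0] = \sum_k (G^`M(k)).@[v] * w k &
    forall s, G.@[fun k => v k + s * w k] = G.@[v] + s * Q.[s].
have expandsC c : expands c%:MP.
  exists 0 => [|s]; last by rewrite !mevalC horner0 mulr0 addr0.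
  by rewrite horner0 big1 // => k _; rewrite mderivC meval0 mul0r.
have expands1 : expands 1 by rewrite -mpolyC1.
have expandsM G H : expands G -> expands H -> expands (G * H).
  move=> [P P0 GE] [Q Q0 HE].
  exists (P * H.@[v]%:P + G.@[v]%:P * Q + 'X * P * Q) => [|s].
    rewrite !hornerE P0 Q0 mulr_suml mulr_sumr -big_split /=.
    by apply: eq_bigr => k _; rewrite mderivM mevalD !mevalM mulrDl mulrA mulrAC.
  rewrite !mevalM GE HE !hornerE.
  by move: (G.@[v]) (H.@[v]) (P.[s]) (Q.[s]) => a b c d; ring.
have expandsD G H : expands G -> expands H -> expands (G + H).
  move=> [P P0 GE] [Q Q0 HE]; exists (P + Q) => [|s].
    rewrite !hornerE P0 Q0 -big_split /=.
    by apply: eq_bigr => k _; rewrite mderivD mevalD mulrDl.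
  by rewrite hornerD mulrDr 2!mevalD GE HE addrACA.
have expandsX i : expands 'X_i.
  exists (w i)%:P => [|s]; last by rewrite !mevalXU hornerC.
  rewrite hornerC (bigD1 i) //= big1 => [|k neq_ki].
    rewrite addr0 mderivX mnm1E eqxx scale1r mevalX big1 ?mul1r // => j _.
    by rewrite mnmBE subnn.
  by rewrite mderivX mnm1E eq_sym (negPf neq_ki) scale0r meval0 mul0r.
change (expands F); elim/mpolyind: F => [|c m G _ _ IHG].
  by rewrite -mpolyC0.
apply: expandsD IHG; rewrite -mul_mpolyC; apply: (expandsM) => //.
rewrite mpolyXE_id; apply: (big_ind expands expands1 expandsM) => i _.
elim: (m i) => [|k IHk]; first by rewrite expr0.
by rewrite exprS; exact: expandsM.
Qed.

Lemma dhomog_meval_scale (n d : nat) (A : comNzRingType) (F : {mpoly A[n]})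
    (c : A) (v : 'I_n -> A) :
  F \is d.-homog -> F.@[fun k => c * v k] = c ^+ d * F.@[v].
Proof.
move=> /dhomogP hF; rewrite !mevalE mulr_sumr; apply: eq_big_seq => m /hF <-.
rewrite mulrCA; congr (_ * _); under eq_bigr do rewrite exprMn.
by rewrite big_split /= prodrXr mdegE.
Qed.

(** * Homogenization *)

Section Homogenization.

Variables (p : nat) (A : comNzRingType).
Implicit Types (q : {mpoly A[p]}) (v : 'I_p.+1 -> A).

Lemma mdeg_le_deg q m : m \in msupp q -> (mdeg m <= deg q)%N.
Proof. by move=> /msize_mdeg_lt lt_m; rewrite -ltnS (ltn_predK lt_m). Qed.

Lemma homogenize_dhomog q : homogenize q \is (deg q).-homog.
Proof.
rewrite /homogenize big_seq; apply: rpred_sum => m q_m; apply: rpredZ.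
have XE (i : 'I_p.+1) k : ('X_i ^+ k : {mpoly A[p.+1]}) \is k.-homog.
  by rewrite -[k in k.-homog]mul1n dhomogMn // dhomogX /= mdeg1.
suff : 'X_ord0 ^+ (deg q - mdeg m) * \prod_(i < p) 'X_(lift ord0 i) ^+ m i
    \is [in A[p.+1], (deg q - mdeg m + mdeg m).-homog].
  by rewrite subnK ?mdeg_le_deg.
apply: dhomogM; first exact: XE.
rewrite mdegE; elim/big_ind2: _ => // [|a d b e]; first exact: dhomog1.
exact: dhomogM.
Qed.

Lemma meval_homogenize q v :
  (homogenize q).@[v] = \sum_(m <- msupp q)
    q@_m * (v ord0 ^+ (deg q - mdeg m) * \prod_(i < p) v (lift ord0 i) ^+ m i).
Proof.
rewrite /homogenize raddf_sum /=; apply: eq_bigr => m _.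
rewrite mevalZ mevalM rmorphXn rmorph_prod /= mevalXU.
by under eq_bigr do rewrite rmorphXn /= mevalXU.
Qed.

Lemma meval_homogenize_at1 q v :
  v ord0 = 1 -> (homogenize q).@[v] = q.@[fun i => v (lift ord0 i)].
Proof.
move=> v0; rewrite meval_homogenize mevalE; apply: eq_bigr => m _.
by rewrite v0 expr1n mul1r.
Qed.

(** Positive powers of u_0 accompany all the monomials of q below the top
    degree, and vanish at infinity. *)
Lemma meval_homogenize_at0 q v :
  v ord0 = 0 -> (homogenize q).@[v] = (top_part q).@[fun i => v (lift ord0 i)].
Proof.
move=> v0; rewrite meval_homogenize /top_part /pihomog raddf_sum /=.
rewrite [RHS]big_mkcond /=.
apply: eq_big_seq => m /mdeg_le_deg le_m.
rewrite mevalZ mevalX v0; case: eqP => [->|/eqP neq_m].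
  by rewrite subnn expr0 mul1r.
by rewrite expr0n subn_eq0 leqNgt ltn_neqAle neq_m le_m /= mul0r mulr0.
Qed.

Lemma meval_homogenize_homog q d v :
  q \is d.-homog -> (homogenize q).@[v] = q.@[fun i => v (lift ord0 i)].
Proof.
move=> /dhomog_msize/dhomogP hq; rewrite meval_homogenize mevalE.
apply: eq_big_seq => m /hq eq_m.
by rewrite /deg eq_m subnn expr0 mul1r.
Qed.

End Homogenization.

(** * Closures along lines and along the sphere *)

Section Closure.

Variable R : realType.

Lemma closure_line (n : nat) (S : set 'rV[R]_n) (a b : 'rV[R]_n) :
  (\forall s \near 0^'+, S (a + s *: b)) -> closure S a.
Proof.
move=> nearS B Ba.
have line_cvg : a + s *: b @[s --> 0^'+] --> a.
  apply: cvg_at_right_filter; rewrite -[X in _ --> X]addr0 -(scale0r b).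
  by apply: cvgD; [exact: cvg_cst | apply: cvgZr_tmp; exact: cvg_id].
have [s [Ss Bs]] := filter_ex (filterI nearS (line_cvg B Ba)).
by exists (a + s *: b).
Qed.

Lemma near0_meval_line_gt0 (n : nat) (F : {mpoly R[n]}) (v w : 'I_n -> R) :
  0 < F.@[v] \/ F.@[v] = 0 /\ 0 < \sum_k (F^`M(k)).@[v] * w k ->
  \forall s \near 0^'+, 0 < F.@[fun k => v k + s * w k].
Proof.
have [Q Q0 FE] := meval_line_expansion F v w.
have near_pos (P : {poly R}) : 0 < P.[0] -> \forall s \near 0^'+, 0 < P.[s].
  have P_cvg := cvg_at_right_filter (@derive.continuous_horner R P 0).
  by move=> P0; exact: P_cvg (lt_nbhsr P0).
case=> [Fv_gt0|[Fv0]].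
  have /near_pos : 0 < (F.@[v]%:P + 'X * Q).[0] by rewrite !hornerE.
  by apply: filterS => s; rewrite FE !hornerE.
rewrite -Q0 => /near_pos Q_gt0; near=> s.
rewrite FE Fv0 add0r; apply: mulr_gt0; first by near: s; exact: nbhs_right_gt.
by near: s.
Unshelve. all: by end_near. Qed.

(** Radial projection to the sphere is continuous at a point of the sphere and
    fixes it. *)
Lemma closure_normalize (n : nat) (S V : set 'rV[R]_n) (x : 'rV[R]_n) :
  \sum_k x ord0 k ^+ 2 = 1 ->
  (forall z, V z -> S ((Num.sqrt (\sum_k z ord0 k ^+ 2))^-1 *: z)) ->
  closure V x -> closure S x.
Proof.
move=> x1 VS clVx B Bx.
pose N (z : 'rV[R]_n) : 'rV[R]_n := (Num.sqrt (\sum_k z ord0 k ^+ 2))^-1 *: z.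
have Nx : N x = x by rewrite /N x1 sqrtr1 invr1 scale1r.
pose sqn (z : 'rV[R]_n) : R := \sum_k z ord0 k ^+ 2.
have sqn_cvg : sqn z @[z --> x] --> sqn x.
  apply: (@cvg_big _ _ _ 0 predT add_continuous _ (nbhs x)) => k _.
  apply: (continuous_cvg _ (@realfun.exprn_continuous R 2 _)).
  exact: coord_continuous.
have norm_cvg : Num.sqrt (sqn z) @[z --> x] --> Num.sqrt (sqn x).
  exact: (continuous_cvg _ (@realfun.sqrt_continuous R _) sqn_cvg).
have N_cvg : N z @[z --> x] --> x.
  rewrite -[X in _ --> X]Nx; apply: (cvgZ _ cvg_id); apply: cvgV norm_cvg.
  by rewrite /sqn x1 sqrtr1 oner_neq0.
have [z [Vz Bz]] := clVx _ (N_cvg B Bx).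
by exists (N z); split => //; exact: VS.
Qed.

End Closure.

(** * Points at infinity *)

Section Infinity.

Variables (R : realType) (p : nat).

Lemma row_mx_ord0 (a : 'rV[R]_1) (u : 'rV[R]_p) :
  row_mx a u ord0 (ord0 : 'I_(1 + p)) = a ord0 ord0.
Proof.
have -> : (ord0 : 'I_(1 + p)) = lshift p ord0 by exact: val_inj.
by rewrite row_mxEl.
Qed.

Lemma row_mx0_ord0 (u : 'rV[R]_p) :
  row_mx (0 : 'rV[R]_1) u ord0 (ord0 : 'I_(1 + p)) = 0.
Proof. by rewrite row_mx_ord0 mxE. Qed.

Lemma row_mx1_ord0 (u : 'rV[R]_p) :
  row_mx (1%:M : 'rV[R]_1) u ord0 (ord0 : 'I_(1 + p)) = 1.
Proof. by rewrite row_mx_ord0 mxE. Qed.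

Lemma row_mx_lift0 (a : 'rV[R]_1) (u : 'rV[R]_p) (i : 'I_p) :
  row_mx a u ord0 (lift ord0 i : 'I_(1 + p)) = u ord0 i.
Proof.
have -> : (lift ord0 i : 'I_(1 + p)) = rshift 1 i by exact: val_inj.
by rewrite row_mxEr.
Qed.

Lemma hhat_lift (m1 : nat) (h : 'I_m1 -> {mpoly R[p]}) (j : 'I_m1) :
  hhat h (lift ord_max j) = top_part (h j).
Proof. by rewrite /hhat liftK. Qed.

(** The approximation of (0, u) goes through two successive closures, since how
    small u_0 has to be taken depends on the distance covered along w. *)
Lemma closure_U0_of_direction (m1 : nat) (h : 'I_m1 -> {mpoly R[p]})
    (u w : 'rV[R]_p) :
  \sum_k u ord0 k ^+ 2 = 1 ->
  (forall i, \forall s \near 0^'+,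
     0 < (top_part (h i)).@[fun k => u ord0 k + s * w ord0 k]) ->
  closure (U0 h) (row_mx (0 : 'rV[R]_1) u).
Proof.
move=> u1 hw.
(* A cone over points of U0: radial projection sends it into U0. *)
pose cone := [set z : 'rV[R]_p.+1 |
  (forall i, 0 < (homogenize (h i)).@[z ord0]) /\ 0 < z ord0 ord0].
(* The same inequalities on the hyperplane at infinity. *)
pose cone0 := [set z : 'rV[R]_p.+1 |
  (forall i, 0 < (homogenize (h i)).@[z ord0]) /\ z ord0 ord0 = 0].
pose e0 : 'rV[R]_p.+1 := delta_mx 0 ord0.
have cone_closure z : cone0 z -> closure cone z.
  move=> [hz z0]; apply: (@closure_line _ _ _ _ e0).
  have near_hz : \forall s \near 0^'+, forall i,
      0 < (homogenize (h i)).@[fun k => z ord0 k + s * e0 ord0 k].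
    by apply: filter_forall => i; apply: near0_meval_line_gt0; left.
  near=> s; split => [i|]; last first.
    by rewrite !mxE z0 add0r !eqxx mulr1; near: s; exact: nbhs_right_gt.
  rewrite (meval_eq (v2 := fun k => z ord0 k + s * e0 ord0 k)).
    by move: i; near: s.
  by move=> k; rewrite !mxE.
apply: (closure_normalize (V := cone)).
- rewrite big_ord_recl row_mx0_ord0 expr0n add0r.
  by under eq_bigr do rewrite row_mx_lift0.
- move=> z [hz z0]; set r := Num.sqrt _.
  have S0 : 0 < \sum_k z ord0 k ^+ 2.
    rewrite big_ord_recl ltr_pwDl ?exprn_gt0 //.
    by apply: sumr_ge0 => k _; exact: sqr_ge0.
  have r0 : 0 < r by rewrite sqrtr_gt0.
  split=> [i||].
  + rewrite (meval_eq (v2 := fun k => r^-1 * z ord0 k)); last first.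
      by move=> k; rewrite mxE.
    rewrite (dhomog_meval_scale _ _ (homogenize_dhomog _)).
    by apply: mulr_ge0 (ltW (hz i)); rewrite exprn_ge0 // invr_ge0 ltW.
  + by rewrite mxE mulr_gt0 ?invr_gt0.
  + under eq_bigr do rewrite mxE exprMn.
    by rewrite -mulr_sumr exprVn sqr_sqrtr ?ltW // mulVf ?gt_eqF.
- apply: closed_closure; apply: closureS cone_closure _ _.
  apply: (@closure_line _ _ _ _ (row_mx (0 : 'rV[R]_1) w)).
  have near_hw : \forall s \near 0^'+, forall i,
      0 < (top_part (h i)).@[fun k => u ord0 k + s * w ord0 k].
    exact: filter_forall hw.
  have at_infinity s : (row_mx (0 : 'rV[R]_1) u + s *: row_mx (0 : 'rV[R]_1) w)
      ord0 (ord0 : 'I_(1 + p)) = 0.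
    by rewrite mxE row_mx0_ord0 mxE row_mx0_ord0 mulr0 addr0.
  near=> s; split=> [i|]; last exact: at_infinity.
  rewrite meval_homogenize_at0; last exact: at_infinity.
  rewrite (meval_eq (v2 := fun k => u ord0 k + s * w ord0 k)).
    by move: i; near: s.
  by move=> k; rewrite mxE row_mx_lift0 mxE row_mx_lift0.
Unshelve. all: by end_near. Qed.

(** The rank is that of a complex matrix, but the matrix has real entries, so
    that a right inverse can be found over the reals. *)
Lemma real_direction_of_full_rank (N m : nat) (G : 'I_m -> {mpoly R[N]})
    (v : 'I_N -> R) :
  \rank (jacobian (fun k : 'I_m => map_mpoly (real_complex R) (G k))
                  (real_complex R \o v)) = m ->
  exists w : 'I_N -> R, forall k, \sum_i ((G k)^`M(i)).@[v] * w i = 1.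
Proof.
pose B := \matrix_(k < m, i < N) ((G k)^`M(i)).@[v].
have -> : jacobian (fun k : 'I_m => map_mpoly (real_complex R) (G k))
                   (real_complex R \o v) = map_mx (real_complex R) B.
  by apply/matrixP => k i; rewrite !mxE mderiv_map_mpoly meval_map_mpoly.
rewrite mxrank_map => rankB.
have /row_freeP[W BW] : row_free B by rewrite /row_free rankB.
exists (fun i => (W *m const_mx 1 : 'cV[R]_N) i ord0).
move=> k; transitivity ((B *m (W *m const_mx 1 : 'cV[R]_N)) k ord0).
  by rewrite [RHS]mxE; apply: eq_bigr => i _; rewrite [B _ _]mxE.
by rewrite mulmxA BW mul1mx mxE.
Qed.

(** * A singular common zero *)

Lemma hhat_J_eq0 (m1 : nat) (h : 'I_m1 -> {mpoly R[p]}) (u : 'rV[R]_p) i :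
  \sum_k u ord0 k ^+ 2 = 1 -> i \in J h u -> (hhat h i).@[u ord0] = 0.
Proof.
move=> u1; rewrite in_setU1 => /orP[/eqP->|/imsetP[j]]; last first.
  by rewrite inE => /eqP hj ->.
rewrite /hhat unlift_none mevalB meval1 raddf_sum /=.
by under eq_bigr do rewrite rmorphXn /= mevalXU; rewrite u1 subrr.
Qed.

(** The point (1, u) of complex projective space, at which both discriminant and
    resultant are tested. *)
Definition affine_point (u : 'rV[R]_p) : 'I_p.+1 -> R[i] :=
  real_complex R \o row_mx (1%:M : 'rV[R]_1) u ord0.

Lemma affine_point_neq0 u : exists k, affine_point u k != 0.
Proof. by exists ord0; rewrite /affine_point /= row_mx1_ord0 rmorph1 oner_neq0. Qed.

Lemma meval_homogenize_affine_point q (u : 'rV[R]_p) :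
  (map_mpoly (real_complex R) (homogenize q)).@[affine_point u] =
  (q.@[u ord0])%:C%C.
Proof.
rewrite meval_map_mpoly meval_homogenize_at1 ?row_mx1_ord0 //; congr (_%:C)%C.
by apply: meval_eq => i; rewrite row_mx_lift0.
Qed.

Lemma homogenize_complex_dhomog (q : {mpoly R[p]}) :
  map_mpoly (real_complex R) (homogenize q) \is (deg q).-homog.
Proof.
have /dhomogP hq := homogenize_dhomog q.
apply/dhomogP => m; rewrite (perm_mem (msupp_map_mpoly _ _)); first exact: hq.
exact: fmorph_inj.
Qed.

End Infinity.

Theorem theorem4p10 (R : realType) (p m1 : nat) (h : 'I_m1 -> {mpoly R[p]})
    (ubar : 'rV[R]_p) :
  (forall i, h i != 0) ->
  ~ closed_at_infinity h ->
  ubar != 0 ->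
  Utilde h (row_mx (0 : 'rV[R]_1) ubar) ->
  ~ closure (U0 h) (row_mx (0 : 'rV[R]_1) ubar) ->
  ((p < #|J h ubar|)%N ->
     forall f : 'I_p.+1 -> 'I_m1.+1,
       injective f -> (forall k, f k \in J h ubar) ->
     forall Res, is_resultant (K := R[i]) (N := p.+1) (degs (hhat h \o f)) Res ->
       value_at (hhat h \o f) Res = 0) /\
  ((#|J h ubar| <= p)%N ->
     (* enum_val lists the elements of J h ubar in increasing order *)
     let q (k : 'I_#|J h ubar|) := hhat h (enum_val k) in
     forall Delta, is_discriminant (K := R[i]) (N := p.+1) (degs q) Delta ->
       value_at q Delta = 0).
Proof.
move=> _ _ _ [hge0 _ norm1] notcl.
have u1 : \sum_k ubar ord0 k ^+ 2 = 1.
  rewrite -norm1 big_ord_recl row_mx0_ord0 expr0n add0r.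
  by under [RHS]eq_bigr do rewrite row_mx_lift0.
have hhat_ge0 i : 0 <= (top_part (h i)).@[ubar ord0].
  have := hge0 i; rewrite meval_homogenize_at0 ?row_mx0_ord0 //.
  by under meval_eq do rewrite row_mx_lift0.
have zero i : i \in J h ubar ->
    (map_mpoly (real_complex R) (homogenize (hhat h i))).@[affine_point ubar] = 0.
  by move=> iJ; rewrite meval_homogenize_affine_point hhat_J_eq0.
split=> [_ f _ fJ Res HRes|leJp q Delta HDelta].
  apply/(HRes _ _).2 => [k|]; first exact: homogenize_complex_dhomog.
  exists (affine_point ubar); split; first exact: affine_point_neq0.
  by move=> k; exact: zero.
apply/(HDelta _ _).2 => [k|]; first exact: homogenize_complex_dhomog.
exists (affine_point ubar); split; first exact: affine_point_neq0.
split; first by move=> k; apply: zero; exact: enum_valP.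
rewrite (minn_idPl (leqW leJp)) ltn_neqAle rank_leq_row andbT.
apply/eqP => /(real_direction_of_full_rank (G := fun k => homogenize (q k)))[w hw].
apply: notcl; apply: (closure_U0_of_direction (w := \row_k w (lift ord0 k))) => // i.
have [hi0|hi_neq0] := eqVneq (top_part (h i)).@[ubar ord0] 0; last first.
  by apply: near0_meval_line_gt0; left; rewrite lt_neqAle eq_sym hi_neq0 hhat_ge0.
have iJ : lift ord_max i \in J h ubar.
  by rewrite in_setU1 imset_f ?orbT // inE hhat_lift hi0.
have qE : q (enum_rank_in iJ (lift ord_max i)) = top_part (h i).
  by rewrite /q enum_rankK_in // hhat_lift.
have dir := hw (enum_rank_in iJ (lift ord_max i)); rewrite qE in dir.
pose a : 'I_p.+1 -> R := row_mx (1%:M : 'rV[R]_1) ubar ord0.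
(* The homogenization of a form does not involve u_0, so that its behaviour at
   (1, ubar) along w is that of the form itself at ubar. *)
have homE v : (homogenize (top_part (h i))).@[v] =
    (top_part (h i)).@[fun k => v (lift ord0 k)].
  exact: meval_homogenize_homog (pihomogP _ _ _).
have near_gt0 : \forall s \near 0^'+,
    0 < (homogenize (top_part (h i))).@[fun k => a k + s * w k].
  apply: near0_meval_line_gt0; right; rewrite dir ltr01 homE -hi0; split=> //.
  by apply: meval_eq => k; rewrite /a row_mx_lift0.
apply: filterS near_gt0 => s; rewrite homE.
by congr (0 < _); apply: meval_eq => k; rewrite /a row_mx_lift0 mxE.
Qed.
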